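(* Let $N\ge 3$, $h=2\pi/N$, $\theta_i=2\pi i/N$ and $\mathbf r_i=(\cos\theta_i,\sin\theta_i)$ for $i=0,\dots,N-1$, with indices taken modulo $N$. Let $(\gamma_i)_{i=0}^{N-1}$ be positive real numbers satisfying $$\gamma_{i-1}+\gamma_{i+1}-2\gamma_i\cos h\ge 0,\qquad i=0,\dots,N-1.$$ Then the polygon $\mathbf A_0\mathbf A_1\dots\mathbf A_{N-1}$ with successive vertices $\mathbf A_i=\frac{1}{\gamma_i}\mathbf r_i$, $i=0,\dots,N-1$, is convex.
   Context: Indices are periodic modulo $N$. ''The polygon $\mathbf A_0\dots\mathbf A_{N-1}$ is convex'' means that the closed polygonal line through $\mathbf A_0,\dots,\mathbf A_{N-1}$ in this cyclic order is the boundary of a convex polygon (aligned consecutive vertices being allowed). The numbers $\gamma_i$ play the role of the values at $\theta_i$ of the gauge function, i.e. the inverse of the radial function. *)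

(* Defs.v *)
From HB Require Import structures.
From mathcomp Require Import all_boot all_order all_algebra.
From mathcomp Require Import all_classical all_reals all_analysis.

Set Implicit Arguments.
Unset Strict Implicit.
Unset Printing Implicit Defensive.
Import Order.TTheory GRing.Theory Num.Theory.
Import numFieldNormedType.Exports.

Local Open Scope classical_set_scope.
Local Open Scope ring_scope.

Definition boundary (T : topologicalType) (P : set T) : set T :=
  closure P `\` interior P.

Definition convex_hull (R : realType) (S : set (R * R)) : set (R * R) :=
  smallest (@convex_set R (R * R)%type) S.

(* Convex polygons are full two-dimensional sets: points and segments are
   excluded by the nonempty interior. *)
Definition is_convex_polygon (R : realType) (P : set (R * R)) : Prop :=
  exists s : seq (R * R), P = convex_hull [set` s] /\ interior P !=set0.

(* Point of parameter t on the edge from A i to A (i + 1); [ordS] is the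
   successor modulo N. *)
Definition edge_pt (R : realType) (N : nat) (A : 'I_N -> R * R)
    (i : 'I_N) (t : R) : R * R :=
  (1 - t) *: A i + t *: A (ordS i).

Definition closed_polyline (R : realType) (N : nat) (A : 'I_N -> R * R) :
    set (R * R) :=
  [set p | exists i t, 0 <= t <= 1 /\ p = edge_pt A i t].

(* The edges are taken half-open, so that the parameters (i, t) with
   0 <= t < 1 run over the polygonal line once, and injectivity says that the
   closed polygonal line is a simple closed curve. *)
Definition simple_closed_polyline (R : realType) (N : nat)
    (A : 'I_N -> R * R) : Prop :=
  forall i j s t, 0 <= s < 1 -> 0 <= t < 1 ->
    edge_pt A i s = edge_pt A j t -> i = j /\ s = t.

(* The closed polygonal line through the A i, in this cyclic order, is the
   boundary of a convex polygon. Simplicity is needed for the order to matter: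
   equality of sets alone would not exclude a line running back and forth along
   a side. Nothing prevents consecutive vertices from being aligned. *)
Definition convex_vertex_polygon (R : realType) (N : nat)
    (A : 'I_N -> R * R) : Prop :=
  simple_closed_polyline A /\
  exists P, is_convex_polygon P /\ closed_polyline A = boundary P.

Definition mesh (R : realType) (N : nat) : R := 2 * pi / N%:R.

Definition theta (R : realType) (N : nat) (i : 'I_N) : R :=
  2 * pi * i%:R / N%:R.

Definition radial_dir (R : realType) (N : nat) (i : 'I_N) : R * R :=
  (cos (theta R i), sin (theta R i)).

(* Main.v *)
(** Write [r_k] for the direction of angle [k h], and let [l_k] be the linear
    form equal to [gamma] at [r_k] and [r_(k+1)], so that [l_k = 1] is the line
    through the edge [A_k A_(k+1)]. The hypothesis says that
    [l_(k+1) - l_k] is a nonnegative multiple of [det (r_(k+1), .)]. Going from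
    [i] to [j] around the circle the short way (at most half a turn), these
    determinants have constant sign at [r_j], whence [l_i (r_j) <= gamma_j] for
    all [i] and [j]. So the vertices lie in the polygon cut out by the
    half-planes [l_i <= 1]. Since every nonzero point lies in exactly one of the
    half-open cones spanned by [r_k] and [r_(k+1)], this polygon is the convex
    hull of the vertices, its boundary is the union of the edges, and the edges
    do not overlap. *)
Require Import Defs.
From HB Require Import structures.
From mathcomp Require Import all_boot all_order all_algebra.
From mathcomp Require Import all_classical all_reals all_analysis.
From mathcomp Require Import zify ring lra.

Import Order.TTheory GRing.Theory Num.Theory.
Import numFieldNormedType.Exports.

Local Open Scope classical_set_scope.
Local Open Scope ring_scope.

(** * Convex combinations *)

Lemma convex_setE (R : realType) (V : lmodType R) (A : set V) :
  @convex_set R V A <->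
  (forall x y t, A x -> A y -> 0 <= t <= 1 -> A ((1 - t) *: x + t *: y)).
Proof.
split=> [cA x y t Ax Ay t01|cA x y t]; last first.
  rewrite !inE => Ax Ay; have := cA y x t%:num Ay Ax; rewrite addrC.
  by apply; rewrite ge0 le1.
move: (t01) => /andP[t0 t1].
have := cA y x (Itv01 t0 t1); rewrite !inE addrC => /(_ Ay Ax).
by [].
Qed.

Lemma convex_set_conv3 (R : realType) (V : lmodType R) (A : set V) (x y z : V)
    (a b : R) : @convex_set R V A -> A x -> A y -> A z ->
  0 <= a -> 0 <= b -> a + b <= 1 -> A (a *: x + b *: y + (1 - a - b) *: z).
Proof.
move=> /convex_setE cA Ax Ay Az a0 b0 ab1.
have [ab0|ab0] := eqVneq (a + b) 0.
  have -> : a = 0 by lra.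
  have -> : b = 0 by lra.
  by rewrite !scale0r !subr0 !add0r scale1r.
have t01 : 0 <= b / (a + b) <= 1.
  have ab_gt0 : 0 < a + b by rewrite lt_neqAle eq_sym ab0 addr_ge0.
  by rewrite divr_ge0 ?(ltW ab_gt0)//= ler_pdivrMr// mul1r lerDr.
(* [z] is joined to the point of parameter [b / (a + b)] on the segment from [x] to [y]. *)
have -> : a *: x + b *: y + (1 - a - b) *: z = (1 - (a + b)) *: z
    + (a + b) *: ((1 - b / (a + b)) *: x + (b / (a + b)) *: y).
  rewrite scalerDr !scalerA mulrBr mulr1 mulrCA divff// mulr1 addrK addrC.
  by rewrite opprD [1 + (_ + _)]addrA.
by apply: (cA) => //; [exact: cA|rewrite addr_ge0].
Qed.

(** * Finite intersections of half-spaces *)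

Section HalfSpaces.
Context (R : realType) (V : normedModType R) (J : finType).
Variable f : J -> {linear V -> R^o}.
Hypothesis f_cts : forall i, continuous (f i).

Let P : set V := [set v | forall i, f i v <= 1].

Lemma halfspaces_convex : @convex_set R V P.
Proof.
apply/convex_setE => x y t Px Py /andP[t0 t1] i.
rewrite linearD !linearZ /= /GRing.scale /=.
by have := Px i; have := Py i; nra.
Qed.

Lemma halfspaces_closed : closed P.
Proof.
have -> : P = \bigcap_i (f i @^-1` [set x | x <= 1]).
  by apply/seteqP; split=> v Pv i; [move=> _; exact: Pv|exact: (Pv i I)].
apply: closed_bigI => i _; apply: closed_comp; last exact: closed_le.
by move=> x _; exact: f_cts.
Qed.

Lemma halfspaces_interior : interior P = [set v | forall i, f i v < 1].
Proof.
apply/seteqP; split=> v /=; last first.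
  move=> fv; apply: filter_forall => i.
  exact: (cvgr_le _ (f_cts i v) _ (fv i)).
(* Dilating an interior point [v] by [1 + e / 2] stays in [P], which rules out [f i v >= 1]. *)
move=> /= Pv i; have Pv1 : nbhs (1 *: v) P by rewrite scale1r.
have /nbhs_ballP[e /= e0] := @scalel_continuous R V v 1 P Pv1.
move=> /(_ (1 + e / 2)); rewrite /ball /= => /(_ _ i).
rewrite linearZ /= /GRing.scale /= => H.
have {H} : (1 + e / 2) * f i v <= 1.
  apply: H; rewrite opprD addNKr normrN ger0_norm; lra.
have [//|] := ltP (f i v) 1; nra.
Qed.

Lemma halfspaces_boundary :
  boundary P = [set v | P v /\ exists i, f i v = 1].
Proof.
rewrite /boundary -(proj1 (closure_id P) halfspaces_closed) halfspaces_interior.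
apply/seteqP; split=> v /= [Pv Nv]; split=> //.
  have [//|fN] := pselect (exists i, f i v = 1); case: Nv => i.
  rewrite lt_neqAle Pv andbT; apply/eqP => fiv; apply: fN; by exists i.
by move: Nv => [i fiv] /(_ i); rewrite fiv ltxx.
Qed.

End HalfSpaces.

(** * Periodic sequences *)

Lemma shift_modn (T : Type) (N : nat) (f : nat -> T) :
  (forall k, f (k + N)%N = f k) -> forall k, f (k %% N)%N = f k.
Proof.
move=> fN k; rewrite [in RHS](divn_eq k N) addnC.
elim: (k %/ N)%N => [|q IH]; first by rewrite mul0n addn0.
by rewrite mulSn addnCA addnC fN.
Qed.

(** Going once round, [f k = f (k + N) <= f k.+1]. *)
Lemma shift_homo_const (R : realType) (N : nat) (f : nat -> R) :
  (0 < N)%N -> (forall k, f (k + N)%N = f k) ->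
  (forall k, f k.+1 <= f k) -> forall k, f k.+1 = f k.
Proof.
move=> N0 fN fS k; apply/eqP; rewrite eq_le fS /= -[X in X <= _]fN.
have noninc j : f (k.+1 + j)%N <= f k.+1.
  by elim: j => [|j IH]; rewrite ?addn0// addnS (le_trans (fS _)).
by rewrite -(prednK N0) addnS -addSn.
Qed.

(** * Sines of multiples of the mesh angle *)

Section RegularDirections.
Context (R : realType) (N : nat).
Hypothesis N_ge3 : (3 <= N)%N.
Implicit Types (u v : R * R) (i j k m : nat).

Let h : R := mesh R N.
Let c := cos h.
Let s := sin h.

Let N_neq0 : N%:R != 0 :> R.
Proof. by rewrite pnatr_eq0; lia. Qed.

Let N_gt0 : 0 < N%:R :> R.
Proof. by rewrite ltr0n; lia. Qed.

Lemma meshN : N%:R * h = pi *+ 2.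
Proof. by rewrite /h /mesh -mulr_natl; field. Qed.

Lemma mesh_gt0 : 0 < h.
Proof. by rewrite divr_gt0// mulr_gt0// pi_gt0. Qed.

Lemma natmul_mesh m : m%:R * h = m.*2%:R / N%:R * pi.
Proof. by rewrite /h /mesh -addnn natrD; field. Qed.

Lemma sin_mesh_ge0 m : (m.*2 <= N)%N -> 0 <= sin (m%:R * h).
Proof.
move=> mN; apply: sin_ge0_pi; rewrite mulr_ge0 ?(ltW mesh_gt0)//=.
by rewrite natmul_mesh ger_pMl ?pi_gt0// ler_pdivrMr// mul1r ler_nat.
Qed.

Lemma sin_mesh_gt0 m : (0 < m)%N -> (m.*2 < N)%N -> 0 < sin (m%:R * h).
Proof.
move=> m0 mN; apply: sin_gt0_pi; rewrite mulr_gt0 ?mesh_gt0 ?ltr0n//=.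
by rewrite natmul_mesh gtr_pMl ?pi_gt0// ltr_pdivrMr// mul1r ltr_nat.
Qed.

Lemma sin_meshC m : (m <= N)%N -> sin ((N - m)%:R * h) = - sin (m%:R * h).
Proof.
by move=> mN; rewrite natrB// mulrBl meshN -sinN addrC sinD2pi.
Qed.

Lemma sin_mesh_le0 m : (N <= m.*2)%N -> (m <= N)%N -> sin (m%:R * h) <= 0.
Proof. by move=> mN ?; rewrite -oppr_ge0 -sin_meshC// sin_mesh_ge0//; lia. Qed.

Lemma sin_mesh1_gt0 : 0 < s.
Proof. by have := sin_mesh_gt0 1; rewrite mul1r; apply; lia. Qed.

Lemma cos_mesh_lt1 : c < 1.
Proof.
have := cos2Dsin2 h; rewrite -/c -/s => cs.
by have := sin_mesh1_gt0; nra.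
Qed.

(** * Determinants and cones of consecutive directions *)

Definition cross u v := u.1 * v.2 - u.2 * v.1.

(** Indexed by [nat], so that inductions around the circle never reduce modulo [N]. *)
Definition dir k : R * R := (cos (k%:R * h), sin (k%:R * h)).

Lemma dirDN k : dir (k + N) = dir k.
Proof. by rewrite /dir natrD mulrDl meshN cosD2pi sinD2pi. Qed.

(** By the addition formulas, [dir k + dir k.+2] is [2 * c] times [dir k.+1]. *)
Lemma cross_dir_rec k v :
  cross (dir k.+2) v = 2 * c * cross (dir k.+1) v - cross (dir k) v.
Proof.
rewrite /cross /dir /=.
have -> : k.+2%:R * h = k.+1%:R * h + h by rewrite -[k.+2]addn1 natrD; ring.
have -> : k%:R * h = k.+1%:R * h - h by rewrite -[k.+1]addn1 natrD; ring.
by rewrite cosD cosB sinD sinB -/c -/s; ring.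
Qed.

Lemma crossC u v : cross u v = - cross v u.
Proof. by rewrite /cross; ring. Qed.

Lemma crossvv u : cross u u = 0.
Proof. by rewrite /cross mulrC subrr. Qed.

Lemma crossDr (a b : R) u v w :
  cross w (a *: u + b *: v) = a * cross w u + b * cross w v.
Proof. by rewrite /cross /= /GRing.scale /=; ring. Qed.

Lemma cross_dir k m : cross (dir k) (dir (k + m)) = sin (m%:R * h).
Proof.
have -> : m%:R * h = (k + m)%:R * h - k%:R * h by rewrite natrD; ring.
by rewrite sinB /cross /=; ring.
Qed.

Lemma cross_dirS k : cross (dir k) (dir k.+1) = s.
Proof. by rewrite -addn1 cross_dir mul1r. Qed.

(* Coordinates of [v] in the basis ([dir k], [dir k.+1]), by Cramer's rule. *)
Definition coordl k v := cross v (dir k.+1) / s.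
Definition coordr k v := cross (dir k) v / s.

Lemma coord_dir k v : v = coordl k v *: dir k + coordr k v *: dir k.+1.
Proof.
have s0 : s != 0 by rewrite gt_eqF// sin_mesh1_gt0.
rewrite /coordl /coordr.
have := cross_dirS k; rewrite /cross; case: v => x y sE.
apply: injective_projections; rewrite /= /GRing.scale /= -sE.
all: move: s0; rewrite -sE /dir /= => s0; by field.
Qed.

(** Around the circle [cross (dir k) v] must change from nonnegative to negative, since by [aux] a
    constant sign would force it, hence [v], to vanish; [v] lies in the cone where the change
    occurs. *)
Lemma dir_cone v : v != 0 ->
  exists k, 0 < coordl k v /\ 0 <= coordr k v.
Proof.
move=> v0.
(* The successive differences of a solution x >= 0 of
   x_(k+2) = 2 c x_(k+1) - x_k are nonincreasing, since c <= 1. *)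
have aux w : (forall k, 0 <= cross (dir k) w) ->
    forall k, cross (dir k) w = 0.
  move=> x0; set f := fun k => cross (dir k.+1) w - cross (dir k) w.
  have fE k : f k.+1 = f k + 2 * (c - 1) * cross (dir k.+1) w.
    by rewrite /f cross_dir_rec; ring.
  have fN k : f (k + N)%N = f k by rewrite /f -addSn !dirDN.
  have fS k : f k.+1 <= f k.
    rewrite fE gerDl; have := cos_mesh_lt1; have := x0 k.+1; nra.
  have z k : cross (dir k.+1) w = 0.
    have := shift_homo_const _ _ _ _ fN fS k; rewrite fE => /(_ ltac:(lia)).
    move/eqP; rewrite addrC -subr_eq0 addrK mulf_eq0 => /orP[|/eqP//].
    by have := cos_mesh_lt1; lra.
  by case=> [|k]//; rewrite -dirDN; have -> : (0 + N = N.-1.+1)%N by lia.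
have nz : ~ (forall k, cross (dir k) v = 0).
  move=> z; case/eqP: v0; rewrite (coord_dir 0 v) /coordl /coordr crossC !z.
  by rewrite oppr0 mul0r !scale0r addr0.
have [[k kv]|] := pselect (exists k, 0 <= cross (dir k) v); last first.
  move=> nk; case: nz => k; apply/eqP; rewrite -oppr_eq0; apply/eqP.
  have crossN u : cross u (- v) = - cross u v by rewrite /cross /=; ring.
  rewrite -crossN; apply: aux => j; rewrite crossN oppr_ge0 leNgt.
  by apply/negP => /ltW jv; apply: nk; exists j.
have [[j [jv jv']]|nj] := pselect
    (exists j, 0 <= cross (dir j) v /\ cross (dir j.+1) v < 0).
  exists j; rewrite /coordl /coordr divr_ge0 ?(ltW sin_mesh1_gt0)//; split => //.
  by rewrite divr_gt0 ?sin_mesh1_gt0// crossC oppr_gt0.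
(* Without such a change, nonnegativity propagates forward from [k], and by periodicity to every
   index. *)
have up m : 0 <= cross (dir (k + m)) v.
  elim: m => [|m IH]; first by rewrite addn0.
  by rewrite addnS leNgt; apply/negP => ?; apply: nj; exists (k + m)%N.
case: nz; apply: aux => j.
have DqN q : dir (j + q * N) = dir j.
  by elim: q => [|q IH]; rewrite ?addn0// mulSn addnCA addnC dirDN.
rewrite -(DqN k).
have -> : (j + k * N = k + (j + (k * N - k)))%N by nia.
exact: up.
Qed.

(** Within one cone, the determinants with [dir j] and [dir j.+1] read off the coefficients; two
    different cones would give their common point conflicting signs. *)
Lemma dir_cone_inj i j (a b a' b' : R) :
  (i < N)%N -> (j < N)%N -> 0 < a -> 0 <= b -> 0 < a' -> 0 <= b' ->
  a *: dir i + b *: dir i.+1 = a' *: dir j + b' *: dir j.+1 ->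
  [/\ i = j, a = a' & b = b'].
Proof.
wlog ij : i j a b a' b' / (i <= j)%N.
  move=> H iN jN a0 b0 a'0 b'0 E; have [ij|/ltnW ji] := leqP i j; first exact: H.
  by case: (H j i a' b' a b).
move=> iN jN a0 b0 a'0 b'0 E; have s0 := sin_mesh1_gt0.
have crossl k x y : cross (dir k) (x *: dir k + y *: dir k.+1) = y * s.
  by rewrite crossDr crossvv cross_dirS mulr0 add0r.
have crossr k x y : cross (dir k.+1) (x *: dir k + y *: dir k.+1) = - (x * s).
  by rewrite crossDr crossvv [cross _ (dir k)]crossC cross_dirS; ring.
have [ijE|nij] := eqVneq i j.
  move: E; rewrite {}ijE => E.
  move: (congr1 (cross (dir j)) E); rewrite !crossl => /mulIf bb.
  move: (congr1 (cross (dir j.+1)) E); rewrite !crossr => /oppr_inj/mulIf aa.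
  by rewrite aa ?bb ?gt_eqF.
have lij : (i < j)%N by rewrite ltn_neqAle nij.
have [d jE] : exists d, j = (i + d.+1)%N by exists (j - i).-1; lia.
have El := congr1 (cross (dir j)) E; have Er := congr1 (cross (dir j.+1)) E.
rewrite crossl crossDr !(crossC (dir j)) {1}jE cross_dir in El.
rewrite {1}jE -addSnnS cross_dir in El.
rewrite crossr crossDr !(crossC (dir j.+1)) in Er.
rewrite {1}jE -addnS cross_dir {1}jE -addSnnS -addnS cross_dir in Er.
(* [El] makes [cross (dir j)] >= 0 and [Er] makes [cross (dir j.+1)] < 0 on the
   common point; one of them fails according to whether [d.+1 * h < pi]. *)
have [dN|dN] := ltnP d.+1.*2 N.
  have := sin_mesh_gt0 d.+1 isT dN; have := sin_mesh_ge0 d ltac:(lia).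
  nra.
have := sin_mesh_le0 d.+1 dN ltac:(lia).
have := sin_mesh_le0 d.+2 ltac:(lia) ltac:(lia).
nra.
Qed.

(** * Linear forms interpolating the gauge *)

Section Gauge.
Variable g : nat -> R.
Hypothesis g_gt0 : forall k, 0 < g k.
Hypothesis gDN : forall k, g (k + N)%N = g k.
Hypothesis g_cvx : forall k, 0 <= g k + g k.+2 - 2 * g k.+1 * c.

Definition gauge_lin k v := coordl k v * g k + coordr k v * g k.+1.
Local Notation lin := gauge_lin.

(** Both forms agree at [dir k.+1], hence differ by a multiple of [cross (dir k.+1)], with a factor
    that [g_cvx] makes nonnegative. *)
Lemma gauge_linS k v :
  lin k.+1 v = lin k v
    + (g k + g k.+2 - 2 * g k.+1 * c) / s * cross (dir k.+1) v.
Proof.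
have s0 : s != 0 by rewrite gt_eqF// sin_mesh1_gt0.
rewrite /lin /coordl /coordr !(crossC v) cross_dir_rec.
by field.
Qed.

Lemma gauge_lin_dir k : lin k (dir k) = g k.
Proof.
have s0 : s != 0 by rewrite gt_eqF// sin_mesh1_gt0.
by rewrite /lin /coordl /coordr crossvv cross_dirS divff//; ring.
Qed.

Lemma gauge_linS_dir k : lin k.+1 (dir k.+1) = lin k (dir k.+1).
Proof. by rewrite gauge_linS crossvv mulr0 addr0. Qed.

(** As the index of the form climbs to [k + m], its value at [dir (k + m)] does not decrease, the
    remaining angle being at most half a turn. *)
Lemma gauge_lin_le_fwd k m : (m.*2 <= N)%N ->
  lin k (dir (k + m)) <= g (k + m)%N.
Proof.
move=> mN; rewrite -gauge_lin_dir.
suff H t : (t <= m)%N -> lin k (dir (k + m)) <= lin (k + t) (dir (k + m)).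
  exact: H.
elim: t => [|t IH] tm; first by rewrite addn0.
apply: le_trans (IH (ltnW tm)) _; rewrite addnS gauge_linS lerDl.
rewrite mulr_ge0 ?divr_ge0 ?g_cvx ?(ltW sin_mesh1_gt0)//.
have -> : (k + m = (k + t).+1 + (m - t.+1))%N by lia.
by rewrite cross_dir sin_mesh_ge0//; lia.
Qed.

(** Here the direction lies behind: the determinants are nonpositive, so the value never rises above
    [g k]. *)
Lemma gauge_lin_le_bwd k m : (m.*2 <= N)%N -> lin (k + m) (dir k) <= g k.
Proof.
move=> mN; rewrite -gauge_lin_dir.
suff H t : (t <= m)%N -> lin (k + t) (dir k) <= lin k (dir k) by exact: H.
elim: t => [|t IH] tm; first by rewrite addn0.
apply: le_trans (IH (ltnW tm)); rewrite addnS gauge_linS gerDl.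
rewrite mulr_ge0_le0 ?divr_ge0 ?g_cvx ?(ltW sin_mesh1_gt0)//.
by rewrite crossC -addnS cross_dir oppr_le0 sin_mesh_ge0//; lia.
Qed.

Lemma gauge_linDN k v : lin (k + N) v = lin k v.
Proof. by rewrite /lin /coordl /coordr -!addSn !gDN !dirDN. Qed.

Lemma gauge_lin_le i j : lin i (dir j) <= g j.
Proof.
rewrite -(shift_modn _ _ _ dirDN) -(shift_modn _ _ _ gDN).
rewrite -(shift_modn _ _ (fun k => lin k _) (fun k => gauge_linDN k _) i).
have: (i %% N < N)%N by rewrite ltn_pmod//; lia.
have: (j %% N < N)%N by rewrite ltn_pmod//; lia.
move: (i %% N)%N (j %% N)%N => {}i {}j jN iN.
have [ij|/ltnW ji] := leqP i j.
  have [mN|mN] := leqP (j - i).*2 N.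
    by have := gauge_lin_le_fwd i _ mN; rewrite subnKC.
  (* The short way from [j] to [i] passes through the index [N]. *)
  rewrite -gauge_linDN; have -> : (i + N = j + (N - (j - i)))%N by lia.
  by apply: gauge_lin_le_bwd; lia.
have [mN|mN] := leqP (i - j).*2 N.
  by have := gauge_lin_le_bwd j _ mN; rewrite subnKC.
rewrite -gDN -dirDN; have -> : (j + N = i + (N - (i - j)))%N by lia.
by apply: gauge_lin_le_fwd; lia.
Qed.


Lemma gauge_lin_is_linear k : linear (lin k : R * R -> R^o).
Proof.
move=> a u v; rewrite /lin /coordl /coordr /cross /= /GRing.scale /=.
have s0 : s != 0 by rewrite gt_eqF// sin_mesh1_gt0.
by rewrite -/s; field.
Qed.

HB.instance Definition _ k :=
  GRing.isLinear.Build R (R * R)%type R^o _ (lin k) (gauge_lin_is_linear k).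

Lemma gauge_lin_continuous k : continuous (lin k : R * R -> R^o).
Proof.
have s0 : s != 0 by rewrite gt_eqF// sin_mesh1_gt0.
pose p := ((dir k.+1).2 * g k - (dir k).2 * g k.+1) / s.
pose q := ((dir k).1 * g k.+1 - (dir k.+1).1 * g k) / s.
have -> : lin k = fun v => p * v.1 + q * v.2.
  apply/funext => v; rewrite /lin /coordl /coordr /cross /p /q -/s.
  by field.
move=> v.
apply: (@cvgD R R^o _ (nbhs v) _ (fun v => p * v.1) (fun v => q * v.2)).
  apply: (@cvgM R _ (nbhs v) _ (fun=> p) fst); first exact: cvg_cst.
  exact: cvg_fst.
apply: (@cvgM R _ (nbhs v) _ (fun=> q) snd); first exact: cvg_cst.
exact: cvg_snd.
Qed.

(** * The vertices and the polygon they span *)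

Definition vertex k : R * R := (g k)^-1 *: dir k.

Lemma vertexDN k : vertex (k + N) = vertex k.
Proof. by rewrite /vertex gDN dirDN. Qed.

Lemma gauge_lin_comb i (a b : R) u v :
  lin i (a *: u + b *: v) = a * lin i u + b * lin i v.
Proof. by rewrite linearD !linearZ. Qed.

Lemma gauge_lin_vertex_le i k : lin i (vertex k) <= 1.
Proof.
rewrite linearZ /= /GRing.scale /= mulrC ler_pdivrMr// mul1r.
exact: gauge_lin_le.
Qed.

Lemma gauge_lin_vertex k : lin k (vertex k) = 1.
Proof.
by rewrite linearZ /= /GRing.scale /= gauge_lin_dir mulVf// gt_eqF.
Qed.

Lemma gauge_lin_vertexS k : lin k (vertex k.+1) = 1.
Proof.
rewrite linearZ /= /GRing.scale /= -gauge_linS_dir gauge_lin_dir mulVf//.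
by rewrite gt_eqF.
Qed.

Lemma vertex_cone v : v != 0 -> exists k, exists a b,
  [/\ (k < N)%N, 0 < a, 0 <= b & v = a *: vertex k + b *: vertex k.+1].
Proof.
move=> /dir_cone[j [lj rj]].
have jN : (j %% N < N)%N by rewrite ltn_pmod//; lia.
exists (j %% N)%N, (coordl j v * g j), (coordr j v * g j.+1); split => //.
- by rewrite mulr_gt0.
- by rewrite mulr_ge0// ltW.
rewrite (shift_modn _ _ _ vertexDN).
rewrite (shift_modn _ _ (fun i => vertex i.+1) (fun i => vertexDN i.+1)).
rewrite /vertex !scalerA !mulfK ?gt_eqF//; exact: coord_dir.
Qed.

(** Writing [- vertex 0] as [a *: vertex k + b *: vertex k.+1] in its cone and dividing by
    [1 + a + b] makes [0] a convex combination of vertices. *)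
Lemma convex_set_vertex0 (A : set (R * R)) :
  @convex_set R (R * R)%type A -> (forall k, A (vertex k)) -> A 0.
Proof.
move=> cA Av.
have N0 : - vertex 0 != 0.
  rewrite oppr_eq0; apply/eqP => v0; have := gauge_lin_vertex 0.
  by rewrite v0 linear0; apply/eqP; rewrite eq_sym oner_eq0.
have [k [a [b [_ a0 b0 vE]]]] := vertex_cone _ N0.
have w0 : 0 < 1 + a + b by lra.
have := convex_set_conv3 _ _ A (vertex k) (vertex k.+1) (vertex 0)
  (a / (1 + a + b)) (b / (1 + a + b)) cA (Av _) (Av _) (Av _).
rewrite !divr_ge0 ?(ltW w0) ?(ltW a0)// -mulrDl ler_pdivrMr// mul1r.
rewrite -addrA lerDr ler01 => /(_ isT isT isT).
have -> : 1 - a / (1 + (a + b)) - b / (1 + (a + b)) = (1 + (a + b))^-1.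
  by field; rewrite addrA gt_eqF.
rewrite ![_ / (1 + (a + b))]mulrC -!scalerA -!scalerDr -vE.
by rewrite addNr scaler0.
Qed.

Definition gauge_polygon : set (R * R) :=
  [set v | forall i : 'I_N, lin i v <= 1].

Lemma gauge_polygon_hull : gauge_polygon = convex_hull (range vertex).
Proof.
apply/seteqP; split=> v.
  move=> Pv A [cA Av].
  have {}Av k : A (vertex k) by apply: Av; exists k.
  have [->|/vertex_cone[k [a [b [kN a0 b0 vE]]]]] := eqVneq v 0.
    exact: convex_set_vertex0.
  (* In the cone of [k] this form takes the value [a + b], so [v] is a convex combination of two
     vertices and [0]. *)
  have := Pv (Ordinal kN); rewrite /= {1}vE gauge_lin_comb.
  rewrite gauge_lin_vertex gauge_lin_vertexS !mulr1 => ab1.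
  have := convex_set_conv3 _ _ A _ _ _ a b cA (Av k) (Av k.+1)
    (convex_set_vertex0 _ cA Av) (ltW a0) b0 ab1.
  by rewrite scaler0 addr0 -vE.
apply: smallest_sub v; last by move=> _ [k _ <-] i; exact: gauge_lin_vertex_le.
exact: (@halfspaces_convex _ _ _ (fun i : 'I_N => lin i)).
Qed.

Lemma gauge_polygon_interior0 : (interior gauge_polygon) 0.
Proof.
have -> : interior gauge_polygon = [set v | forall i : 'I_N, lin i v < 1].
  apply: (@halfspaces_interior _ _ _ (fun i : 'I_N => lin i)) => i.
  exact: gauge_lin_continuous.
by move=> i; rewrite linear0 ltr01.
Qed.

Lemma gauge_polygon_boundary : boundary gauge_polygon =
  [set v | exists (i : 'I_N) (t : R), 0 <= t <= 1 /\
    v = (1 - t) *: vertex i + t *: vertex i.+1].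
Proof.
rewrite (@halfspaces_boundary _ _ _ (fun i : 'I_N => lin i)); last first.
  by move=> i; exact: gauge_lin_continuous.
apply/seteqP; split=> v /=; last first.
  move=> [i [t [/andP[t0 t1] vE]]]; split => [j|]; last first.
    exists i; rewrite vE gauge_lin_comb.
    by rewrite gauge_lin_vertex gauge_lin_vertexS; lra.
  rewrite vE gauge_lin_comb.
  by have := gauge_lin_vertex_le j i; have := gauge_lin_vertex_le j i.+1; nra.
move=> [Pv [i vi]].
have v0 : v != 0.
  by apply/eqP => v0; move: vi; rewrite v0 linear0 => /esym/eqP; rewrite oner_eq0.
have [k [a [b [kN a0 b0 vE]]]] := vertex_cone _ v0.
have ab_le1 : a + b <= 1.
  have := Pv (Ordinal kN); rewrite /= {1}vE gauge_lin_comb.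
  by rewrite gauge_lin_vertex gauge_lin_vertexS !mulr1.
(* The tight form [lin i] need not be that of the cone containing [v], but it is at most 1 at both
   vertices, so [1 = lin i v <= a + b]. *)
have ab_ge1 : 1 <= a + b.
  rewrite -vi {1}vE gauge_lin_comb.
  by have := gauge_lin_vertex_le i k; have := gauge_lin_vertex_le i k.+1; nra.
exists (Ordinal kN), b; split; first by lra.
by have -> : 1 - b = a by lra.
Qed.

(** [x < 1] makes the coefficient of [dir i] positive, so half-open edges sit in the half-open cones
    of [dir_cone_inj]. *)
Lemma vertex_edge_inj i j (x y : R) : (i < N)%N -> (j < N)%N ->
  0 <= x < 1 -> 0 <= y < 1 ->
  (1 - x) *: vertex i + x *: vertex i.+1 =
    (1 - y) *: vertex j + y *: vertex j.+1 -> i = j /\ x = y.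
Proof.
move=> iN jN /andP[x0 x1] /andP[y0 y1]; rewrite /vertex !scalerA => E.
have [] := dir_cone_inj _ _ _ _ _ _ iN jN _ _ _ _ E.
- by rewrite divr_gt0// subr_gt0.
- by rewrite divr_ge0// ltW.
- by rewrite divr_gt0// subr_gt0.
- by rewrite divr_ge0// ltW.
by move=> -> _ /mulIf ->//; rewrite invr_eq0 gt_eqF.
Qed.

End Gauge.
End RegularDirections.

Theorem mainTheorem2 (R : realType) (N : nat) (hN : (3 <= N)%N)
    (gamma : 'I_N -> R)
    (gamma_gt0 : forall i : 'I_N, 0 < gamma i)
    (gamma_cvx : forall i : 'I_N,
      0 <= gamma (ord_pred i) + gamma (ordS i)
           - 2 * gamma i * cos (mesh R N)) :
  convex_vertex_polygon (fun i : 'I_N => (gamma i)^-1 *: radial_dir R i).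
Proof.
have N_gt0 : (0 < N)%N by lia.
(* [gamma] is extended to an [N]-periodic sequence on [nat]. *)
pose o k := Ordinal (ltn_pmod k N_gt0); pose g k := gamma (o k).
have oE (i : 'I_N) k : (k %% N)%N = i -> o k = i by move=> ki; apply/val_inj.
have ord_o (i : 'I_N) : o i = i by apply: oE; rewrite modn_small.
have g_gt0 k : 0 < g k by exact: gamma_gt0.
have gDN k : g (k + N)%N = g k.
  by congr gamma; apply: oE; rewrite /= modnDr.
have ordS_o k : ordS (o k) = o k.+1.
  by apply/val_inj; rewrite /= -addn1 modnDml addn1.
have g_cvx k : 0 <= g k + g k.+2 - 2 * g k.+1 * cos (mesh R N).
  (* The hypothesis is centred at the middle index [k.+1]. *)
  by have := gamma_cvx (ordS (o k)); rewrite ordSK !ordS_o.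
set A := fun i : 'I_N => _.
have AE i : A i = vertex _ N g i.
  rewrite /A /vertex /g ord_o /radial_dir /dir /theta /mesh.
  by rewrite mulrA [2 * pi * _]mulrC.
(* For the last [i], [ordS i] is 0 while [i.+1] is [N]; periodicity identifies the two vertices. *)
have ASE i : A (ordS i) = vertex _ N g i.+1.
  by rewrite AE /= (shift_modn _ _ _ (vertexDN _ _ hN _ gDN)).
split.
  move=> i j x y x01 y01; rewrite /edge_pt !ASE !AE => E.
  have [/val_inj -> ->] := vertex_edge_inj _ _ hN g g_gt0 i j x y
    (ltn_ord i) (ltn_ord j) x01 y01 E.
  by [].
exists (gauge_polygon _ N g); split.
  exists [seq A i | i <- enum 'I_N]; split; last first.
    by exists 0; exact: gauge_polygon_interior0.
  rewrite gauge_polygon_hull//; congr convex_hull.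
  apply/seteqP; split=> v /=.
    move=> [k _ <-]; apply/mapP; exists (o k); first by rewrite mem_enum.
    by rewrite AE /= (shift_modn _ _ _ (vertexDN _ _ hN _ gDN)).
  by move=> /mapP[i _ ->]; exists i; rewrite ?AE.
rewrite gauge_polygon_boundary//; apply/seteqP; split=> v /= [i [t [t01 ->]]].
  by exists i, t; rewrite /edge_pt ASE AE.
by exists i, t; rewrite /edge_pt ASE AE.
Qed.
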